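(* Given any simplicial complex $\Delta$ whose vertex set is bipartitioned into two sets $\mathfrak{L}$ and $\mathfrak{R}$, we can construct an invariant strong placement game (iSP-game) $(R,B)$ such that $\Delta=\Delta_{R,B}$ and the set of Left (respectively Right) positions is $\mathfrak{L}$ (respectively $\mathfrak{R}$).
   Context: A simplicial complex on a finite vertex set $V$ is a set of subsets of $V$, called faces, closed under taking subsets; its facets are its maximal faces. A board is a finite graph. A ruleset $R$ specifies which pieces each of the two players, Left and Right, may place (each piece occupies a non-empty collection of vertices of the board) and which placements are legal; $(R,B)$ denotes the game with ruleset $R$ played on board $B$. A position is a configuration of pieces on the board. A basic position is a board with only one piece placed (a Left or Right basic position according to who placed the piece); the ''Left (Right) positions'' in the claim are the Left (Right) basic positions. A position is legal if it can be reached through a sequence of legal moves, and illegal otherwise. A strong placement game (SP-game) is a combinatorial game (two players, perfect information, no chance, no simultaneous moves) such that: (i) the board is empty at the beginning of the game; (ii) players place pieces on empty spaces of the board according to the rules; (iii) pieces are not moved or removed once placed; (iv) if it is possible to reach a position through a sequence of legal moves, then any sequence of moves leading to this position consists of legal moves. Hence a position is identified with the set of basic positions it is made of, and every subset of a legal position is legal. The legal complex $\Delta_{R,B}$ is the simplicial complex whose vertex set is the set of basic positions and whose facets are the maximal legal positions; its faces are the legal positions. Equality $\Delta=\Delta_{R,B}$ is understood with the vertices of $\Delta$ in $\mathfrak{L}$ corresponding to Left basic positions and those in $\mathfrak{R}$ to Right basic positions. A board isomorphism between two boards (possibly already containing pieces) is a graph isomorphism such that a vertex contains a Left (respectively Right)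 piece if and only if its image does. The ruleset of an SP-game is invariant if: every basic position is legal; and the ruleset does not depend on the board, i.e. for any board isomorphism between boards $B_1$ and $B_2$, a move in $B_1$ is legal if and only if its isomorphic image in $B_2$ is legal. An SP-game with invariant ruleset is an invariant strong placement game (iSP-game). *)

(* Defs.v *)
From HB Require Import structures.
From mathcomp Require Import all_boot.
From mathcomp Require Import boolp.
Set Implicit Arguments. Unset Strict Implicit. Unset Printing Implicit Defensive.

(* [V] is only an ambient type: the vertices of a complex are the v whose
   singleton is a face.  The complex without any face is excluded, because the
   empty position of a game is always legal. *)
Record simplicial_complex (V : finType) := SimplicialComplex {
  faces :> {set {set V}};
  face_empty : set0 \in faces;
  face_subset : forall F G : {set V}, G \in faces -> F \subset G -> F \in faces
}.

Definition vertices (V : finType) (D : simplicial_complex V) : {set V} :=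
  [set v | [set v] \in faces D].

Record board := Board {
  cell :> finType;
  adj : rel cell;
  adj_sym : symmetric adj;
  adj_irr : irreflexive adj
}.

Definition graph_iso (B1 B2 : board) (f : B1 -> B2) : Prop :=
  bijective f /\ forall x y, adj (f x) (f y) = adj x y.

Section Induced.
Variables (B : board) (S : {set B}).
Definition induced_adj : rel {x : B | x \in S} :=
  fun x y => adj (val x) (val y).
Fact induced_sym : symmetric induced_adj.
Proof. by move=> x y; apply: adj_sym. Qed.
Fact induced_irr : irreflexive induced_adj.
Proof. by move=> x; apply: adj_irr. Qed.
Definition induced : board := Board induced_sym induced_irr.
End Induced.

Variant player := Left | Right.

Definition bool_of_player (p : player) := if p is Left then true else false.
Definition player_of_bool (b : bool) := if b then Left else Right.
Fact bool_of_playerK : cancel bool_of_player player_of_bool.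
Proof. by case. Qed.
HB.instance Definition _ := Finite.copy player (can_type bool_of_playerK).

(* A piece is a shape, that is, a finite graph up to isomorphism.  It can be put
   on a set of vertices of the board exactly when the subgraph induced on this
   set has that shape, so that whether a piece fits never depends on the rest of
   the board.  [pieces p] is the (possibly infinite) family of the pieces of the
   player [p]. *)
Record piece_set := PieceSet {
  pieces :> player -> pred board;
  pieces_iso : forall p (H1 H2 : board) (f : H1 -> H2),
    graph_iso f -> pieces p H1 = pieces p H2
}.

Definition basic_position (K : piece_set) (B : board) : Type :=
  {x : player * {set B} | (x.2 != set0) && K x.1 (induced x.2)}.
HB.instance Definition _ K B := Finite.on (basic_position K B).

Definition owner K B (m : basic_position K B) : player := (val m).1.
Definition support K B (m : basic_position K B) : {set B} := (val m).2.

(* A position is the set of the pieces on the board. *)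
Definition position (K : piece_set) (B : board) : Type :=
  {set basic_position K B}.

Definition occupied K B (P : position K B) : {set B} :=
  \bigcup_(m in P) support m.

Definition contains_piece K B (P : position K B) (p : player) (v : B) : bool :=
  [exists m in P, (owner m == p) && (v \in support m)].

(* [legal_move P m] : placing the piece [m] is legal when the board already
   contains the pieces of [P].  A single ruleset covers all boards. *)
Record ruleset := Ruleset {
  piece_kinds :> piece_set;
  legal_move : forall B : board,
    position piece_kinds B -> basic_position piece_kinds B -> bool
}.

Section Game.
Variables (R : ruleset) (B : board).
Implicit Types (P : position R B) (m : basic_position R B).
Implicit Types s : seq (basic_position R B).

(* The players need not alternate. *)
Fixpoint legal_moves_from P s : bool :=
  if s is m :: s' then legal_move P m && legal_moves_from (m |: P) s'
  else true.

Definition legal_sequence s : bool := legal_moves_from set0 s.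

Definition legal_position P : Prop :=
  exists2 s, legal_sequence s & [set m in s] = P.

(* That the board is empty at the beginning, and that pieces are neither moved
   nor removed, is built into [legal_sequence].  In the second clause, [uniq s]
   only says that no piece is placed twice at the same place. *)
Definition sp_game : Prop :=
  (forall P m, legal_move P m -> [disjoint support m & occupied P]) /\
  (forall P s, legal_position P -> uniq s -> [set m in s] = P ->
     legal_sequence s).

Definition maximal_legal : pred {set basic_position R B} :=
  maxset (fun P => `[< legal_position P >]).

Definition legal_faces : {set {set basic_position R B}} :=
  [set F : {set basic_position R B} | [exists P, maximal_legal P && (F \subset P)]].

Fact legal_position0 : legal_position set0.
Proof. by exists [::] => //; apply/setP => m; rewrite !inE. Qed.

Fact legal_face_empty : set0 \in legal_faces.
Proof.
have [|P maxP _] := @maxset_exists _ (fun P => `[< legal_position P >]) set0.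
  by apply/asboolP; exact: legal_position0.
by rewrite inE; apply/existsP; exists P; rewrite /maximal_legal maxP sub0set.
Qed.

Fact legal_face_subset (F G : {set basic_position R B}) :
  G \in legal_faces -> F \subset G -> F \in legal_faces.
Proof.
rewrite !inE => /existsP[P /andP[maxP sGP]] sFG.
by apply/existsP; exists P; rewrite maxP (subset_trans sFG).
Qed.

Definition legal_complex : simplicial_complex (basic_position R B) :=
  SimplicialComplex legal_face_empty legal_face_subset.

Definition player_positions (p : player) : {set basic_position R B} :=
  [set m | owner m == p].

Lemma legal_moves_from_cat P s t :
  legal_moves_from P (s ++ t) ->
  legal_moves_from P s.
Proof. by elim: s P => //= m s IHs P /andP[-> /IHs]. Qed.

Lemma legal_complexE (F : {set basic_position R B}) :
  sp_game -> F \in faces legal_complex <-> legal_position F.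
Proof.
case=> _ perm; split=> [|legF].
  rewrite inE => /existsP[P /andP[/maxsetP[/asboolP legP _] sFP]].
  exists (enum F); last by apply/setP=> m; rewrite inE mem_enum.
  apply: (@legal_moves_from_cat _ _ (enum (P :\: F))); apply: (perm P) => //.
    rewrite cat_uniq !enum_uniq andbT; apply/hasPn => m.
    by rewrite !mem_enum inE => /andP[].
  apply/setP=> m; rewrite inE mem_cat !mem_enum inE.
  by case: (boolP (m \in F)) => //= /(subsetP sFP) ->.
have [|P maxP sFP] := @maxset_exists _ (fun P => `[< legal_position P >]) F.
  exact/asboolP.
by rewrite inE; apply/existsP; exists P; rewrite /maximal_legal maxP.
Qed.

End Game.

(* An isomorphism of boards that already contain pieces only has to respect
   which vertices are occupied by Left and which by Right; it need not match
   the pieces of [P1] with those of [P2]. *)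
Definition board_iso K (B1 B2 : board)
    (P1 : position K B1) (P2 : position K B2) (f : B1 -> B2) : Prop :=
  graph_iso f /\
  forall p v, contains_piece P1 p v = contains_piece P2 p (f v).

Definition image_piece K (B1 B2 : board) (f : B1 -> B2)
    (m1 : basic_position K B1) (m2 : basic_position K B2) : Prop :=
  owner m2 = owner m1 /\ support m2 = f @: support m1.

Definition invariant_ruleset (R : ruleset) : Prop :=
  (forall (B : board) (m : basic_position R B), legal_position [set m]) /\
  (forall (B1 B2 : board) (P1 : position R B1) (P2 : position R B2)
          (f : B1 -> B2) (m1 : basic_position R B1) (m2 : basic_position R B2),
     board_iso P1 P2 f -> image_piece f m1 m2 ->
     legal_move P1 m1 = legal_move P2 m2).

(* An invariant ruleset can be played on any board, so the axioms of strong
   placement games are required on all boards. *)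
Definition isp_ruleset (R : ruleset) : Prop :=
  (forall B : board, sp_game R B) /\ invariant_ruleset R.

(* Main.v *)
(* Let S_v be the graph on #|V| + 2 cells in which exactly the first
   [enum_rank v].+1 cells are adjacent to all the others, and there are no other
   edges.  The board is the disjoint union of the S_v, and the piece of v is S_v.
   A set of #|V| + 2 cells with a dominating cell lies in one component, hence
   fills it, so each piece fits at exactly one place.  On any board a move is
   legal when the pieces stay disjoint and the v whose piece fits somewhere in
   the occupied cells form a face of Delta.  This last condition passes to
   smaller sets of cells, hence the order of moves is irrelevant. *)
From mathcomp Require Import all_boot.
Require Import Defs.
Set Implicit Arguments. Unset Strict Implicit. Unset Printing Implicit Defensive.

(** * Shapes told apart by their dominating cells, and the board made of them *)

Definition dominating (B : board) (T : {set B}) : {set B} :=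
  [set x in T | [forall y in T, (y != x) ==> adj x y]].

Lemma dominating_imset (B1 B2 : board) (f : B1 -> B2) (T : {set B1}) :
  injective f -> (forall x y, adj (f x) (f y) = adj x y) ->
  dominating (f @: T) = f @: dominating T.
Proof.
move=> finj fadj; apply/setP => z; apply/idP/imsetP.
  rewrite inE => /andP[/imsetP[x xT ->] /forall_inP dom].
  exists x; rewrite // inE xT; apply/forall_inP => y yT.
  by have := dom _ (imset_f f yT); rewrite (inj_eq finj) fadj.
case=> x; rewrite inE => /andP[xT /forall_inP dom] ->.
rewrite inE imset_f //=; apply/forall_inP => _ /imsetP[y yT ->].
by rewrite (inj_eq finj) fadj dom.
Qed.

Section Shapes.
Variable V : finType.

(** Two cardinals stand in for an isomorphism with S_v. The condition is weaker in general, but it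
    is invariant under isomorphism and singles out one set of cells on [shape_board]. *)
Definition has_shape (v : V) (B : board) (T : {set B}) : bool :=
  (#|T| == #|V|.+2) && (#|dominating T| == (enum_rank v).+1).

Lemma has_shape_imset v (B1 B2 : board) (f : B1 -> B2) (T : {set B1}) :
  injective f -> (forall x y, adj (f x) (f y) = adj x y) ->
  has_shape v (f @: T) = has_shape v T.
Proof.
by move=> finj fadj; rewrite /has_shape dominating_imset // !card_imset.
Qed.

Lemma has_shape_induced v (B : board) (T : {set B}) :
  has_shape v [set: induced T] = has_shape v T.
Proof.
rewrite -(@has_shape_imset v (induced T) B val) //; last exact: val_inj.
congr has_shape; apply/setP => x; apply/imsetP/idP => [[y _ ->]|xT].
  exact: (valP y).
by exists (Sub x xT).
Qed.

Lemma has_shape_inj u v (B : board) (T : {set B}) :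
  has_shape u T -> has_shape v T -> u = v.
Proof.
move=> /andP[_ /eqP cardT] /andP[_]; rewrite cardT eqSS => /eqP uv.
exact/enum_rank_inj/val_inj.
Qed.

Definition shape_adj : rel (V * 'I_#|V|.+2) := fun x y =>
  [&& x.1 == y.1, x.2 != y.2
    & (x.2 <= enum_rank x.1) || (y.2 <= enum_rank y.1)].

Fact shape_adj_sym : symmetric shape_adj.
Proof.
by move=> x y; rewrite /shape_adj [x.1 == _]eq_sym [x.2 == _]eq_sym orbC.
Qed.

Fact shape_adj_irr : irreflexive shape_adj.
Proof. by move=> x; rewrite /shape_adj !eqxx. Qed.

Definition shape_board : board := Board shape_adj_sym shape_adj_irr.

Definition component (v : V) : {set shape_board} := [set x | x.1 == v].

Lemma card_component v : #|component v| = #|V|.+2.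
Proof.
have -> : component v = [set (v, i) | i in 'I_#|V|.+2].
  apply/setP => -[u i]; rewrite inE /=; apply/eqP/imsetP => [->|[j _ [-> _]]//].
  by exists i.
by rewrite card_imset ?card_ord // => i j [].
Qed.

Lemma dominating_component v :
  dominating (component v) =
    [set x : shape_board in component v | x.2 <= enum_rank v].
Proof.
apply/setP => -[u i]; rewrite !inE /=; case: eqP => //= ->.
apply/forall_inP/idP => [dom | leiv [w j]]; last first.
  rewrite inE /= => /eqP ->; apply/implyP => neq.
  rewrite /adj /= /shape_adj /= eqxx leiv orTb andbT /=.
  by apply: contraNneq neq => ->.
(* The ranks are at most [#|V|.-1], so at least two cells of index greater
   than [enum_rank v] exist and [i] is not adjacent to the other one. *)
have [j neq ltj] : exists2 j : 'I_#|V|.+2, j != i & enum_rank v < j.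
  have ltv := ltn_ord (enum_rank v).
  have [->|neq] := eqVneq i ord_max; last first.
    by exists ord_max; rewrite 1?eq_sym //= ltnW.
  exists (inord #|V|); last by rewrite inordK.
  by rewrite -val_eqE /= inordK // neq_ltn ltnSn.
have := dom (v, j); rewrite inE eqxx => /(_ isT) /implyP.
rewrite xpair_eqE eqxx => /(_ neq); rewrite /adj /= /shape_adj /=.
by case/and3P=> _ _; rewrite [j <= _]leqNgt ltj orbF.
Qed.

Lemma component_has_shape v : has_shape v (component v).
Proof.
rewrite /has_shape card_component eqxx dominating_component /=.
have lev : (enum_rank v).+1 <= #|V|.+2 by rewrite !leqW ?ltn_ord.
pose f (i : 'I_(enum_rank v).+1) : shape_board := (v, widen_ord lev i).
have -> : [set x : shape_board in component v | x.2 <= enum_rank v] =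
          f @: [set: 'I_(enum_rank v).+1].
  apply/setP => -[u i]; rewrite !inE /=; apply/andP/imsetP.
    case=> /eqP -> lti; exists (inord i); rewrite ?inE // /f; congr pair.
    by apply: val_inj; rewrite /= inordK.
  by case=> j _ [-> ->] /=; rewrite eqxx -ltnS.
rewrite card_imset ?cardsT ?card_ord // => i j [eqij].
exact: val_inj.
Qed.

Lemma has_shape_component v (T : {set shape_board}) :
  has_shape v T -> T = component v.
Proof.
move=> shT; have /andP[/eqP cardT /eqP cardD] := shT.
(* The successor in [has_shape] provides a dominating cell even for the vertex of rank 0. *)
have /card_gt0P[x] : 0 < #|dominating T| by rewrite cardD.
rewrite inE => /andP[xT /forall_inP dom].
have defT : T = component x.1.
  apply/eqP; rewrite eqEcard card_component cardT leqnn andbT.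
  apply/subsetP => y yT; rewrite inE.
  have [->//|neq] := eqVneq y x.
  by have /implyP/(_ neq)/and3P[/eqP->] := dom y yT.
(* [T] is some component; its number of dominating cells tells which one. *)
rewrite defT; congr component; apply: (has_shape_inj (T := T)) => //.
by rewrite defT component_has_shape.
Qed.

Lemma component_disjoint u v :
  u != v -> [disjoint component u & component v].
Proof.
move=> neq; rewrite -setI_eq0; apply/eqP/setP => x; rewrite !inE.
by case: eqP => //= ->; apply/negbTE.
Qed.

End Shapes.

(** * Rulesets whose legality depends only on the cells occupied *)

Section OccupancyRuleset.
Variables (K : piece_set) (good : forall B : board, pred {set B}).
Hypothesis good_sub :
  forall (B : board) (S T : {set B}), S \subset T -> good T -> good S.
Hypothesis good0 : forall B : board, good (set0 : {set B}).
Hypothesis good_piece :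
  forall (B : board) (m : basic_position K B), good (support m).
Hypothesis good_iso : forall (B1 B2 : board) (f : B1 -> B2) (S : {set B1}),
  graph_iso f -> good (f @: S) = good S.

(** Legality reads the set of occupied cells and not how it is cut into pieces, since a [board_iso]
    need not preserve the latter. *)
Definition occupancy_ruleset : ruleset :=
  Ruleset (fun B (P : position K B) (m : basic_position K B) =>
    [disjoint support m & occupied P] && good (support m :|: occupied P)).

Let R := occupancy_ruleset.

Lemma occupiedU1 (B : board) (P : position K B) (m : basic_position K B) :
  occupied (m |: P) = support m :|: occupied P.
Proof. by rewrite /occupied bigcup_setU big_set1. Qed.

Lemma occupiedS (B : board) (P Q : position K B) :
  P \subset Q -> occupied P \subset occupied Q.
Proof.
move=> /subsetP sPQ; apply/bigcupsP => m /sPQ mQ.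
exact: (bigcup_sup m).
Qed.

(** The description of legal positions that does not mention the order of moves. *)
Definition admissible (B : board) (P : position K B) : Prop :=
  {in P &, forall m n, m != n -> [disjoint support m & support n]} /\
  good (occupied P).

Lemma disjoint_occupied (B : board) (S : {set B}) (P : position K B) :
  [disjoint S & occupied P] <->
  {in P, forall m, [disjoint S & support m]}.
Proof.
split=> [/bigcup_disjointP dis m /dis // | dis].
exact/bigcup_disjointP.
Qed.

Lemma legal_admissible (B : board) (P : position R B) s :
  admissible P -> legal_moves_from P s -> admissible (P :|: [set m in s]).
Proof.
elim: s P => [|m s IHs] P [disP goodP] /=.
  by move=> _; rewrite (_ : [set _ in _] = set0) ?setU0 //; apply/setP=> x; rewrite !inE.
case/andP=> /andP[/disjoint_occupied dis_m good_m] legs.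
rewrite set_cons setUCA setUA; apply: IHs => //; split; last by rewrite occupiedU1.
move=> x y /setU1P[->|xP] /setU1P[->|yP]; rewrite ?eqxx // => neq.
- exact: dis_m.
- by rewrite disjoint_sym; apply: dis_m.
- exact: disP.
Qed.

(** Every intermediate position is part of the final one, so [good_sub] applies to it. As the pieces
    of [s] are new and distinct, pairwise disjointness makes each of them avoid all cells occupied
    before. *)
Lemma admissible_legal (B : board) (P : position R B) s :
  admissible (P :|: [set m in s]) -> uniq s -> {in s, forall m, m \notin P} ->
  legal_moves_from P s.
Proof.
elim: s P => [|m s IHs] //= P adm /andP[ms uniqs] notP.
have [dis goodU] := adm.
have mU : m \in P :|: [set x in m :: s] by rewrite !inE eqxx orbT.
have sPU : m |: P \subset P :|: [set x in m :: s].
  by rewrite subUset sub1set mU subsetUl.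
apply/andP; split.
  apply/andP; split; last by rewrite -occupiedU1 (good_sub _ goodU) ?occupiedS.
  apply/disjoint_occupied => x xP; apply: dis => //; first by rewrite inE xP.
  by apply: contraNneq (notP m (mem_head _ _)) => ->.
apply: IHs => //; first by rewrite -setUA setUCA -set_cons.
move=> x xs; rewrite !inE negb_or notP ?inE ?xs ?orbT // andbT.
by apply: contraNneq ms => <-.
Qed.

Lemma legal_positionP (B : board) (P : position R B) :
  legal_position P <-> admissible P.
Proof.
split=> [[s legs <-]|admP].
  rewrite -[[set _ in _]]set0U; apply: legal_admissible legs; split.
    by move=> m n; rewrite inE.
  by rewrite /occupied big_set0.
exists (enum P); last by apply/setP => m; rewrite inE mem_enum.
apply: admissible_legal (enum_uniq _) _ => [|m _]; last by rewrite inE.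
by rewrite set0U set_enum.
Qed.

Lemma occupancy_sp_game (B : board) : sp_game R B.
Proof.
split=> [P m /andP[] //|P s /legal_positionP admP uniqs defP].
by apply: admissible_legal => // [|m _]; rewrite ?set0U ?defP ?inE.
Qed.

Lemma mem_occupied (B : board) (P : position K B) x :
  (x \in occupied P) = [exists p, contains_piece P p x].
Proof.
apply/bigcupP/existsP => [[m mP xm]|[p /existsP[m /and3P[mP _ xm]]]].
  by exists (owner m); apply/existsP; exists m; rewrite mP eqxx.
by exists m.
Qed.

(** A cell is occupied when some player has a piece on it, and this is what [board_iso]
    preserves. *)
Lemma occupied_iso (B1 B2 : board) (P1 : position K B1) (P2 : position K B2)
  (f : B1 -> B2) : board_iso P1 P2 f -> occupied P2 = f @: occupied P1.
Proof.
case=> [[[g fK gK] _] fP]; apply/setP => y.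
rewrite -[y]gK mem_imset ?mem_occupied; last exact: can_inj fK.
by apply: eq_existsb => p; rewrite fP.
Qed.

Lemma occupancy_isp : isp_ruleset R.
Proof.
split; first exact: occupancy_sp_game.
split=> [B m|B1 B2 P1 P2 f m1 m2 isof [_ supp]].
  apply/legal_positionP; split=> [x y /set1P -> /set1P ->|]; first by rewrite eqxx.
  by rewrite /occupied big_set1 good_piece.
have [isog _] := isof; have finj := bij_inj isog.1.
rewrite /= supp (occupied_iso isof) -imsetU good_iso //.
by rewrite -!setI_eq0 -imsetI ?imset_eq0 // => x y _ _; exact: finj.
Qed.

End OccupancyRuleset.

(** * Realizing the bipartitioned complex *)

Section Realization.
Variables (V : finType) (Delta : simplicial_complex V) (LL RR : {set V}).
Hypothesis LR_cover : LL :|: RR = vertices Delta.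
Hypothesis LR_disjoint : [disjoint LL & RR].

Definition side (p : player) : {set V} := if p is Left then LL else RR.

Lemma side_vertex p v : v \in side p -> [set v] \in faces Delta.
Proof.
have /setP/(_ v) := LR_cover; rewrite !inE => <-.
by case: p => /= ->; rewrite ?orbT.
Qed.

Lemma side_inj p q v : v \in side p -> v \in side q -> p = q.
Proof.
by case: p; case: q => //= vp vq;
  have := disjointFr LR_disjoint; [move/(_ v vp)|move/(_ v vq)];
  rewrite ?vp ?vq.
Qed.

Definition shape_piece p (H : board) : bool :=
  [exists v in side p, has_shape v [set: H]].

Fact shape_piece_iso p (H1 H2 : board) (f : H1 -> H2) :
  graph_iso f -> shape_piece p H1 = shape_piece p H2.
Proof.
case=> bijf fadj; apply: eq_existsb => v; congr andb.
rewrite -(has_shape_imset v [set: H1] (bij_inj bijf) fadj).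
congr has_shape; apply/setP => y; rewrite inE; have [g _ gK] := bijf.
by rewrite -[y]gK imset_f.
Qed.

Definition shape_pieces : piece_set := PieceSet shape_piece_iso.

(** [T] ranges over all subsets of [S], not only over supports of placed pieces. This makes the
    result depend on the cells alone and grow with [S]. *)
Definition shapes_in (B : board) (S : {set B}) : {set V} :=
  [set v in vertices Delta | [exists T : {set B}, (T \subset S) && has_shape v T]].

Definition shape_good (B : board) (S : {set B}) : bool :=
  shapes_in S \in faces Delta.

Lemma basic_shape (B : board) (m : basic_position shape_pieces B) :
  exists v, (v \in side (owner m)) && has_shape v (support m).
Proof.
have /andP[_ /existsP[v /andP[vp shv]]] := valP m.
by exists v; rewrite vp -has_shape_induced.
Qed.

(** The choice is harmless: by [has_shape_inj] only one vertex qualifies. *)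
Definition label (B : board) (m : basic_position shape_pieces B) : V :=
  xchoose (basic_shape m).

Lemma label_side (B : board) (m : basic_position shape_pieces B) :
  label m \in side (owner m).
Proof. by have /andP[] := xchooseP (basic_shape m). Qed.

Lemma label_shape (B : board) (m : basic_position shape_pieces B) :
  has_shape (label m) (support m).
Proof. by have /andP[] := xchooseP (basic_shape m). Qed.

Lemma shape_good_sub (B : board) (S T : {set B}) :
  S \subset T -> shape_good T -> shape_good S.
Proof.
move=> sST /face_subset; apply; apply/subsetP => v; rewrite !inE.
case/andP=> -> /existsP[U /andP[sUS shU]]; apply/existsP; exists U.
by rewrite (subset_trans sUS).
Qed.

(** All shapes have the same number of cells, so no proper subset of a piece has a shape, and the
    only vertex found is the label of [m]. *)
Lemma shape_good_piece (B : board) (m : basic_position shape_pieces B) :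
  shape_good (support m).
Proof.
apply: (face_subset (side_vertex (label_side m))).
apply/subsetP => v; rewrite !inE => /andP[_ /existsP[T /andP[sT shT]]].
have /andP[/eqP cardT _] := shT; have /andP[/eqP cardm _] := label_shape m.
have defT : T = support m by apply/eqP; rewrite eqEcard sT cardT cardm leqnn.
apply/eqP; apply: has_shape_inj (label_shape m).
by rewrite -defT.
Qed.

Lemma shape_good0 (B : board) : shape_good (set0 : {set B}).
Proof.
apply: (face_subset (face_empty Delta)); apply/subsetP => v.
rewrite !inE => /andP[_ /existsP[T /andP[]]]; rewrite subset0 => /eqP ->.
by rewrite /has_shape cards0.
Qed.

Lemma shape_good_iso (B1 B2 : board) (f : B1 -> B2) (S : {set B1}) :
  graph_iso f -> shape_good (f @: S) = shape_good S.
Proof.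
case=> bijf fadj; have finj := bij_inj bijf.
rewrite /shape_good; suff -> : shapes_in (f @: S) = shapes_in S by [].
apply/setP => v; rewrite !inE; congr andb.
apply/existsP/existsP => -[T /andP[sT shT]]; last first.
  by exists (f @: T); rewrite imsetS // has_shape_imset.
exists (f @^-1: T).
have defT : T = f @: (f @^-1: T).
  apply/setP => y; have [g _ gK] := bijf.
  by rewrite -[y]gK mem_imset // inE.
rewrite -(has_shape_imset v _ finj fadj) -defT shT andbT.
by apply/subsetP => x; rewrite inE => /(subsetP sT); rewrite mem_imset.
Qed.

Definition shape_ruleset : ruleset := occupancy_ruleset shape_pieces shape_good.

Lemma shape_isp : isp_ruleset shape_ruleset.
Proof.
exact: (occupancy_isp shape_good_sub shape_good0 shape_good_piece shape_good_iso).
Qed.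

Local Notation basic := (basic_position shape_ruleset (shape_board V)).

Lemma support_component (m : basic) : support m = component (label m).
Proof. exact: has_shape_component (label_shape m). Qed.

(** On this board the label fixes the support, which is its component, and also the owner, because
    [LL] and [RR] are disjoint. *)
Lemma label_inj : injective (fun m : basic => label m).
Proof.
move=> m n eq_mn; apply: val_inj.
have eqS : support m = support n by rewrite !support_component eq_mn.
have eqO : owner m = owner n.
  by apply: side_inj (label_side m) _; rewrite eq_mn label_side.
by move: eqS eqO; rewrite /support /owner; case: (val m) (val n) => [p S] [q T] /= -> ->.
Qed.

Lemma label_onto p v : v \in side p -> exists2 m : basic, owner m = p & label m = v.
Proof.
move=> vp.
have ok : ((p, component v).2 != set0) &&
    shape_pieces (p, component v).1 (induced (p, component v).2).
  rewrite /= -card_gt0 card_component /=; apply/existsP; exists v.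
  by rewrite vp has_shape_induced component_has_shape.
pose m : basic := Sub (p, component v) ok.
exists m; rewrite // /owner ?SubK //; apply: has_shape_inj (label_shape m) _.
by rewrite /support SubK component_has_shape.
Qed.

Lemma label_player p :
  (fun m : basic => label m) @: player_positions shape_ruleset (shape_board V) p
    = side p.
Proof.
apply/setP => v; apply/imsetP/idP => [[m]|/label_onto[m own <-]].
  by rewrite inE => /eqP <- ->; exact: label_side.
by exists m; rewrite // inE own.
Qed.

(** On other boards neighbouring pieces may create further shapes; here a shape fills a component,
    and only the piece with that label can cover it. *)
Lemma shapes_in_occupied (P : {set basic}) :
  shapes_in (occupied P) = (fun m : basic => label m) @: P.
Proof.
apply/setP => v; rewrite !inE; apply/andP/imsetP => [[_ /existsP[T]]|[m mP ->]].
  case/andP=> sT /has_shape_component defT.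
  (* Any cell of the component would do: the piece covering it has label [v]. *)
  have : ((v, ord0) : shape_board V) \in occupied P.
    by apply: (subsetP sT); rewrite defT inE.
  case/bigcupP => m mP; rewrite support_component inE /= => /eqP ->.
  by exists m.
split; first exact: side_vertex (label_side m).
by apply/existsP; exists (support m); rewrite (label_shape m) andbT; exact: (bigcup_sup m).
Qed.

Lemma legal_faceE (P : {set basic}) :
  (P \in faces (legal_complex shape_ruleset (shape_board V))) =
    ((fun m : basic => label m) @: P \in faces Delta).
Proof.
have legP := legal_complexE P (shape_isp.1 _).
have admP := legal_positionP shape_good_sub shape_good0 P.
rewrite -shapes_in_occupied.
(* Distinct pieces fill distinct components, so disjointness is automatic and only the face
   condition remains. *)
apply/idP/idP => [/legP/admP[] //|goodP]; apply/legP/admP; split=> // m n _ _ neq.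
by rewrite !support_component component_disjoint // (inj_eq label_inj).
Qed.

Lemma faces_legal :
  faces Delta = [set (fun m : basic => label m) @: F | F : {set basic}
                 in faces (legal_complex shape_ruleset (shape_board V))].
Proof.
apply/setP => G; apply/idP/imsetP => [faceG|[F]]; last first.
  by rewrite legal_faceE => faceF ->.
(* The position realizing [G] consists of all pieces with label in [G]; each vertex of [G] has a
   piece because [LL] and [RR] cover the vertices. *)
have defG : G = (fun m : basic => label m) @: [set m | label m \in G].
  apply/setP => v; apply/idP/imsetP => [vG|[m]]; last by rewrite inE => ? ->.
  have : v \in vertices Delta.
    by rewrite inE (face_subset faceG) // sub1set.
  rewrite -LR_cover inE => vLR.
  have [p vp] : exists p, v \in side p.
    by case/orP: vLR => ?; [exists Left | exists Right].
  by have [m _ lm] := label_onto vp; exists m; rewrite ?inE lm.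
by exists [set m | label m \in G]; rewrite // legal_faceE -defG.
Qed.

End Realization.

Theorem theorem2p15 (V : finType) (Delta : simplicial_complex V)
    (LL RR : {set V}) (LR_cover : LL :|: RR = vertices Delta)
    (LR_disjoint : [disjoint LL & RR]) :
  exists (R : ruleset) (B : board) (phi : basic_position R B -> V),
    [/\ isp_ruleset R,
        injective phi,
        faces Delta = [set phi @: F | F : {set basic_position R B}
                                        in faces (legal_complex R B)],
        phi @: player_positions R B Left = LL
      & phi @: player_positions R B Right = RR].
Proof.
exists (shape_ruleset Delta LL RR), (shape_board V), (fun m => label m); split.
- exact: shape_isp.
- exact: label_inj.
- exact: faces_legal.
- exact: (label_player Delta LL RR Left).
- exact: (label_player Delta LL RR Right).
Qed.
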